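(* Let $m,r$ be real numbers with $m\neq 0$. For all integers $\ell,n\ge 0$ and all real numbers $x,y$, $$D_{m,r}(\ell+n;x,y)=\sum_{k=0}^{\ell}\sum_{i=0}^n m^i(mk+r)^{n-i}\binom{n}{i}W_{m,r}(\ell,k)\,B_i\!\left(x-k,\frac{y}{m}\right)(x)_k\,y^k,$$ and $$D_{m,r}(\ell+n)=\sum_{k=0}^{\ell}\sum_{i=0}^n m^i(mk+r)^{n-i}\binom{n}{i}W_{m,r}(\ell,k)\,B_i\!\left(\frac{1}{m}\right).$$
   Context: Falling factorial: $(x)_0=1$ and $(x)_k=x(x-1)\cdots(x-k+1)$ for $k\ge1$. For real $m\neq0$ and real $r$, the $r$-Whitney numbers of the second kind $W_{m,r}(n,k)$, $0\le k\le n$, are defined by the polynomial identity in $t$ $$(mt+r)^n=\sum_{k=0}^n m^kW_{m,r}(n,k)(t)_k .$$ The bivariate $r$-Dowling polynomials are $D_{m,r}(n;x,y)=\sum_{k=0}^nW_{m,r}(n,k)(x)_ky^k$. The $r$-Dowling numbers are $D_{m,r}(n)=\sum_{k=0}^nW_{m,r}(n,k)$. With $S(n,k)$ the Stirling numbers of the second kind, the bivariate Bell polynomials are $B_n(x,y)=\sum_{k=0}^nS(n,k)(x)_ky^k$ and the (univariate) Bell polynomials are $B_n(z)=\sum_{k=0}^nS(n,k)z^k$. The convention $0^0=1$ is used. *)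

(* Defs.v *)
From HB Require Import structures.
From mathcomp Require Import all_boot all_order all_algebra.
From mathcomp Require Import boolp classical_sets reals.

Set Implicit Arguments.
Unset Strict Implicit.
Unset Printing Implicit Defensive.

Import Order.TTheory GRing.Theory Num.Theory.

Local Open Scope ring_scope.

(* Falling factorial (x)_k, over a ring so that it applies both to real numbers
   and to the indeterminate 'X of {poly R}. *)
Definition ffactr (A : nzRingType) (x : A) (k : nat) : A :=
  \prod_(i < k) (x - i%:R).

(* Stirling number of the second kind S(n, k): the number of partitions of an
   n-element set into k nonempty blocks. *)
Definition stirling2 (n k : nat) : nat :=
  #|[set P : {set {set 'I_n}} | finset.partition P [set: 'I_n] & #|P| == k]%SET|.

Section RWhitney.
Variable R : realType.
Implicit Types (m r x y z : R) (n k : nat).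

(* w is the family of coefficients W_{m,r}(n, 0), ..., W_{m,r}(n, n); the values
   beyond n, which are never used, are set to 0 so that w is unique. *)
Definition is_rWhitney2 m r n (w : nat -> R) : Prop :=
  (m *: 'X + r%:P) ^+ n
    = \sum_(k < n.+1) (m ^+ k * w k) *: ffactr 'X k :> {poly R}
  /\ (forall k, (n < k)%N -> w k = 0).

(* Defined by its characteristic identity; is_rWhitney2_unique and rWhitney2P
   below show that this is well posed for m != 0. *)
Definition rWhitney2 m r n : nat -> R :=
  xget (fun=> 0) [set w : nat -> R | is_rWhitney2 m r n w]%classic.

Definition rDowling2 m r n x y : R :=
  \sum_(k < n.+1) rWhitney2 m r n k * ffactr x k * y ^+ k.

Definition rDowling m r n : R := \sum_(k < n.+1) rWhitney2 m r n k.

Definition bell2 n x y : R :=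
  \sum_(k < n.+1) (stirling2 n k)%:R * ffactr x k * y ^+ k.

Definition bell n z : R := \sum_(k < n.+1) (stirling2 n k)%:R * z ^+ k.

Lemma ffactrS (A : nzRingType) (x : A) k :
  ffactr x k.+1 = ffactr x k * (x - k%:R).
Proof. by rewrite /ffactr big_ord_recr. Qed.

Lemma ffactrX_monic k : ffactr ('X : {poly R}) k \is monic.
Proof.
elim: k => [|k IH]; first by rewrite /ffactr big_ord0 monic1.
by rewrite ffactrS monicMl // -polyC_natr monicXsubC.
Qed.

Lemma size_ffactrX k : size (ffactr ('X : {poly R}) k) = k.+1.
Proof.
elim: k => [|k IH]; first by rewrite /ffactr big_ord0 size_poly1.
rewrite ffactrS -polyC_natr size_Mmonic ?monicXsubC ?monic_neq0 ?ffactrX_monic //.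
by rewrite IH size_XsubC addn2.
Qed.

Lemma ffactrX_free (c : nat -> R) n :
  \sum_(k < n) c k *: ffactr 'X k = 0 :> {poly R} ->
  forall k, (k < n)%N -> c k = 0.
Proof.
elim: n => [//|n IH]; rewrite big_ord_recr /= => E.
have cn0 : c n = 0.
  move: (congr1 (fun p : {poly R} => p`_n) E); rewrite coefD coef0 coefZ.
  have -> : (ffactr ('X : {poly R}) n)`_n = 1.
    by move: (monicP (ffactrX_monic n)); rewrite lead_coefE size_ffactrX.
  rewrite coef_sum big1 ?add0r ?mulr1 // => i _.
  by rewrite coefZ nth_default ?mulr0 // size_ffactrX.
move: E; rewrite cn0 scale0r addr0 => /IH {}IH k.
by rewrite ltnS leq_eqVlt => /predU1P[->//|/IH].
Qed.

Lemma is_rWhitney2_unique m r n (w w' : nat -> R) : m != 0 ->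
  is_rWhitney2 m r n w -> is_rWhitney2 m r n w' -> w = w'.
Proof.
move=> m0 [E w0] [E' w'0]; apply/funext => k.
case: (ltnP n k) => [nk|kn]; first by rewrite w0 // w'0.
have /(@ffactrX_free (fun k => m ^+ k * w k - m ^+ k * w' k)) H :
    \sum_(k < n.+1) (m ^+ k * w k - m ^+ k * w' k) *: ffactr 'X k
      = 0 :> {poly R}.
  under eq_bigr do rewrite scalerBl.
  by rewrite sumrB -E -E' subrr.
move/eqP: (H k kn); rewrite -mulrBr mulf_eq0 expf_eq0 (negbTE m0) andbF /=.
by rewrite subr_eq0 => /eqP.
Qed.

Lemma is_rWhitney2_exists m r n : exists w, is_rWhitney2 m r n w.
Proof.
elim: n => [|n [w [E w0]]].
  exists (fun k => (k == 0)%:R); split; last by case.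
  by rewrite big_ord1 /ffactr big_ord0 !expr0 mul1r scale1r.
exists (fun k => (m * k%:R + r) * w k + (if k is j.+1 then w j else 0)).
split; last by case=> [//|k] nk; rewrite !w0 ?mulr0 ?addr0 // ltnW.
rewrite exprSr E big_distrl /=.
have step k : (m ^+ k * w k) *: ffactr 'X k * (m *: 'X + r%:P) =
    (m ^+ k * ((m * k%:R + r) * w k)) *: ffactr 'X k
    + (m ^+ k.+1 * w k) *: ffactr 'X k.+1 :> {poly R}.
  have -> : m *: 'X + r%:P
      = m *: ('X - k%:R) + (m * k%:R + r)%:P :> {poly R}.
    by rewrite polyCD polyCM polyC_natr scalerBr -!mul_polyC addrA subrK.
  rewrite mulrDr -!scalerAl -scalerAr -ffactrS scalerA addrC.
  rewrite (mulrC (ffactr _ _)) mul_polyC scalerA.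
  congr (_ *: _ + _ *: _); first by rewrite -mulrA (mulrC (w k)).
  by rewrite exprSr -!mulrA (mulrC m).
under eq_bigr do rewrite step.
rewrite big_split /= [RHS]
  (_ : _ = \sum_(k < n.+2) ((m ^+ k * ((m * k%:R + r) * w k)) *: ffactr 'X k
  + (m ^+ k * (if k : nat is j.+1 then w j else 0)) *: ffactr 'X k)); last first.
  by apply: eq_bigr => k _; rewrite mulrDr scalerDl.
rewrite big_split /=; congr (_ + _).
  by rewrite [RHS]big_ord_recr /= w0 // !mulr0 scale0r addr0.
by rewrite [RHS]big_ord_recl /= mulr0 scale0r add0r.
Qed.

Lemma rWhitney2P m r n : is_rWhitney2 m r n (rWhitney2 m r n).
Proof. by apply: xgetPex; apply: is_rWhitney2_exists. Qed.

End RWhitney.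

(* Main.v *)
(* Expanding (mt+r)^l in the basis (t)_k, and the remaining factor
   (mt+r)^n = (m(t-k) + (mk+r))^n by the binomial theorem and then in the basis
   (t-k)_j, the rule (t)_k (t-k)_j = (t)_{k+j} expresses W(l+n, s) through the
   W(l, k) and S(i, j) with k+j = s; both identities are this formula summed
   against (x)_s y^s and against 1.  The expansion of t^i in falling factorials
   with counted Stirling numbers is checked at natural t = |U|, by sorting the
   functions T -> U according to the partition of T into their fibres. *)
Require Import Defs.
From mathcomp Require Import all_boot all_order all_algebra.
From mathcomp Require Import reals.
From mathcomp Require Import ring.
Import GRing.Theory.
Local Open Scope ring_scope.

Section FibrePartitions.
Variables T U : finType.
Implicit Types (P : {set {set T}}) (f : {ffun T -> U}).

(** A partition is recovered from its same-block relation, and for the fibre partition of [f] that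
    relation is equality of values. *)
Lemma preim_partition_eqP P f : partition P [set: T] ->
  reflect (forall x y, (f x == f y) = (pblock P x == pblock P y))
          (preim_partition f [set: T] == P).
Proof.
move=> partP; have /and3P[/eqP covP tiP _] := partP.
have eqpb x y : (pblock P x == pblock P y) = (y \in pblock P x).
  by rewrite eq_pblock // covP inE.
apply: (iffP eqP) => [<- x y | fP].
  have /and3P[/eqP covf tif _] := preim_partitionP f [set: T].
  rewrite eq_pblock ?covf ?inE // pblock_equivalence_partition ?inE //.
  by move=> u v w _ _ _; split=> //= /eqP->.
rewrite -[RHS](equivalence_partition_pblock partP).
rewrite /preim_partition /equivalence_partition.
apply: eq_imset => x; apply/setP=> y.
by rewrite !inE /= fP eqpb.
Qed.

(** A function whose fibres are exactly the blocks of [P] factors through the block map as an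
    injection from the set of blocks to [U]; [lift] is this bijection. *)
Lemma card_preim_partition P : partition P [set: T] ->
  #|[set f : {ffun T -> U} | preim_partition f [set: T] == P]|
    = (#|U| ^_ #|P|)%N.
Proof.
move=> partP; have /and3P[/eqP covP tiP nP] := partP.
pose B := {A : {set T} | A \in P}.
have pbP x : pblock P x \in P by rewrite pblock_mem // covP inE.
pose blk x : B := Sub (pblock P x) (pbP x).
have blk_surj (b : B) : exists x, blk x == b.
  have /set0Pn[x xb] : val b != set0.
    by apply: contraNneq nP => <-; apply: valP.
  by exists x; rewrite -val_eqE /= (def_pblock tiP (valP b) xb).
(* A chosen point in each block: evaluating there recovers [g] from [lift g]. *)
pose rep b := xchoose (blk_surj b).
have repK b : blk (rep b) = b by apply/eqP/(xchooseP (blk_surj b)).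
pose lift (g : {ffun B -> U}) : {ffun T -> U} := [ffun x => g (blk x)].
have lift_inj : injective lift.
  move=> g h /ffunP gh; apply/ffunP=> b.
  by have := gh (rep b); rewrite !ffunE repK.
have -> : #|P| = #|{: B}| by rewrite card_sig.
rewrite -card_inj_ffuns -(card_imset _ lift_inj).
apply: eq_card => f; rewrite inE.
apply/preim_partition_eqP/imsetP=> // [fP | [g]].
  exists [ffun b => f (rep b)].
    rewrite inE; apply/injectiveP => b c; rewrite !ffunE => /eqP.
    rewrite fP => /eqP bc; rewrite -[b]repK -[c]repK.
    exact: val_inj.
  apply/ffunP=> x; rewrite !ffunE; apply/eqP; rewrite fP eq_sym.
  by have /(congr1 val) /= -> := repK (blk x).
rewrite inE => /injectiveP g_inj -> x y.
by rewrite !ffunE (inj_eq g_inj) -val_eqE.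
Qed.

End FibrePartitions.

Lemma stirling2_expn (n t : nat) :
  (t ^ n = \sum_(k < n.+1) stirling2 n k * t ^_ k)%N.
Proof.
have -> : (t ^ n = #|{ffun 'I_n -> 'I_t}|)%N by rewrite card_ffun !card_ord.
rewrite -sum1_card.
rewrite (partition_big (fun f : {ffun 'I_n -> 'I_t} =>
    preim_partition f [set: 'I_n])
  (fun P => partition P [set: 'I_n])) => [|f _]; last exact: preim_partitionP.
rewrite (eq_bigr (fun P : {set {set 'I_n}} => (t ^_ #|P|)%N)); last first.
  move=> P partP; rewrite -[in RHS](card_ord t) -card_preim_partition //.
  by rewrite -sum1_card; apply: eq_bigl => f; rewrite inE.
(* Blocks are disjoint and nonempty, so there are at most [n] of them; hence [inord #|P|] below
   loses nothing. *)
have cardP (P : {set {set 'I_n}}) : partition P [set: 'I_n] -> (#|P| < n.+1)%N.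
  move=> partP; have := card_partition partP; rewrite cardsT card_ord => En.
  rewrite ltnS [leqRHS]En -sum1_card; apply: leq_sum => A AP.
  have /and3P[_ _ nP] := partP.
  by rewrite card_gt0; apply: contraNneq nP => <-.
rewrite (partition_big (fun P : {set {set 'I_n}} => inord #|P| : 'I_n.+1)
  predT) //=.
apply: eq_bigr => k _; rewrite /stirling2 -sum_nat_const; apply: eq_big => P.
  rewrite inE; apply: andb_id2l => /cardP lP.
  by rewrite -val_eqE /= inordK.
by case/andP=> /cardP lP /eqP <-; rewrite inordK.
Qed.

Lemma ffactr_nat (A : nzRingType) (t k : nat) :
  ffactr (t%:R : A) k = (t ^_ k)%:R.
Proof.
elim: k => [|k IH]; first by rewrite /ffactr big_ord0.
rewrite ffactrS IH ffactnSr natrM.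
(* For [t < k] the subtraction in [t - k] truncates, but the factor [t ^_ k] is then zero. *)
have [kt | tk] := leqP k t; first by rewrite natrB.
by rewrite ffact_small // !mul0r.
Qed.

Lemma ffactrD (A : nzRingType) (x : A) (k j : nat) :
  ffactr x (k + j) = ffactr x k * ffactr (x - k%:R) j.
Proof.
rewrite /ffactr big_split_ord /=; congr (_ * _).
by apply: eq_bigr => i _; rewrite natrD opprD addrA.
Qed.

Lemma ffactr_horner (A : comNzRingType) (p : {poly A}) (x : A) (k : nat) :
  (ffactr p k).[x] = ffactr p.[x] k.
Proof.
rewrite /ffactr horner_prod; apply: eq_bigr => i _.
by rewrite !hornerE hornerMn hornerC.
Qed.

Lemma ffactr_comp_poly (A : comNzRingType) (p q : {poly A}) (k : nat) :
  ffactr p k \Po q = ffactr (p \Po q) k.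
Proof.
rewrite /ffactr rmorph_prod; apply: eq_bigr => i _.
by rewrite rmorphB rmorph_nat.
Qed.

(** The naturals below the size of [p - q] are distinct in characteristic zero, which gives too many
    roots for a nonzero difference. *)
Lemma poly_eq_nat (F : numDomainType) (p q : {poly F}) :
  (forall t : nat, p.[t%:R] = q.[t%:R]) -> p = q.
Proof.
move=> pq; apply/eqP; rewrite -subr_eq0; apply/eqP.
pose s := [seq (t%:R : F) | t <- iota 0 (size (p - q))].
apply: (@roots_geq_poly_eq0 _ _ s).
- by apply/allP=> _ /mapP[t _ ->]; rewrite rootE hornerD hornerN pq subrr.
- by rewrite map_inj_uniq ?iota_uniq //; apply: Num.Theory.mulrIn; rewrite oner_eq0.
- by rewrite size_map size_iota.
Qed.

Lemma polyX_expn_stirling2 (F : numDomainType) (n : nat) :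
  'X^n = \sum_(k < n.+1) (stirling2 n k)%:R *: ffactr 'X k :> {poly F}.
Proof.
apply: poly_eq_nat => t.
rewrite hornerXn -natrX stirling2_expn natr_sum horner_sum.
by apply: eq_bigr => k _; rewrite hornerZ ffactr_horner hornerX ffactr_nat natrM.
Qed.

Lemma polyXsub_expn_stirling2 (F : numDomainType) (k n : nat) :
  ('X - k%:R) ^+ n =
    \sum_(j < n.+1) (stirling2 n j)%:R *: ffactr ('X - k%:R) j :> {poly F}.
Proof.
have := congr1 (comp_poly ('X - k%:R)) (polyX_expn_stirling2 F n).
rewrite rmorphXn /= comp_polyX => ->; rewrite rmorph_sum.
apply: eq_bigr => j _ /=.
by rewrite comp_polyZ ffactr_comp_poly comp_polyX.
Qed.

Section Addition.
Variables (R : realType) (m r : R) (hm : m != 0) (l n : nat).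

(** The share of the triple [(k, i, j)] in W(l+n, k+j). The expansion produces only [m ^+ k], while
    the defining identity requires [m ^+ (k + j)], whence the division by [m ^+ j]. *)
Let coef (k i j : nat) : R :=
  rWhitney2 m r l k * ('C(n, i)%:R * m ^+ i * (m * k%:R + r) ^+ (n - i))
  * (stirling2 i j)%:R / m ^+ j.

Let conv (s : nat) : R :=
  \sum_(k < l.+1) \sum_(i < n.+1) \sum_(j < i.+1 | (k + j == s)%N) coef k i j.

(** Stated over any module, to serve both for polynomials and, through [R^o], for real weights. *)
Let conv_sum (V : lmodType R) (g : nat -> V) :
  \sum_(s < (l + n).+1) conv s *: g s =
  \sum_(k < l.+1) \sum_(i < n.+1) \sum_(j < i.+1) coef k i j *: g (k + j)%N.
Proof.
under eq_bigr do rewrite scaler_suml.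
rewrite exchange_big; apply: eq_bigr => k _ /=.
under eq_bigr do rewrite scaler_suml.
rewrite exchange_big; apply: eq_bigr => i _ /=.
under eq_bigr do rewrite scaler_suml big_mkcond.
rewrite exchange_big; apply: eq_bigr => j _ /=.
(* The index [k + j] is in range, so exactly one [s] survives the filter. *)
have lt_kj : (k + j < (l + n).+1)%N.
  by rewrite ltnS leq_add // -ltnS // (leq_trans (ltn_ord j)).
rewrite (bigD1 (Ordinal lt_kj)) //= eqxx big1 ?addr0 // => s.
by rewrite -val_eqE /= eq_sym => /negbTE->.
Qed.

Let conv_rWhitney2 : is_rWhitney2 m r (l + n) conv.
Proof.
split; last first.
  move=> s lns; rewrite /conv big1 // => k _; rewrite big1 // => i _.
  rewrite big1 // => j /eqP kj; move: lns; rewrite -kj ltnNge leq_add //.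
    by rewrite -ltnS.
  by rewrite -ltnS (leq_trans (ltn_ord j)).
rewrite exprD (rWhitney2P m r l).1 mulr_suml.
rewrite (eq_bigr (fun s : 'I_(l + n).+1 =>
  conv s *: (m ^+ s *: ffactr 'X s))); last first.
  by move=> s _; rewrite scalerA mulrC.
rewrite (conv_sum _ (fun s => m ^+ s *: ffactr 'X s)).
apply: eq_bigr => k _.
(* Recentring at [k] makes the powers of ['X - k%:R] expand into factors that continue
   [ffactr 'X k]. *)
have -> : m *: 'X + r%:P = (m * k%:R + r)%:P + m *: ('X - k%:R) :> {poly R}.
  rewrite polyCD polyCM polyC_natr scalerBr -!mul_polyC.
  by rewrite [RHS]addrC addrA subrK.
rewrite exprDn mulr_sumr; apply: eq_bigr => i _.
rewrite exprZn polyXsub_expn_stirling2 scaler_sumr mulr_sumr.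
rewrite -sumrMnl mulr_sumr; apply: eq_bigr => j _.
rewrite ffactrD -polyC_exp mul_polyC !scalerA -scaler_nat scalerA.
rewrite -scalerAl -scalerAr !scalerA; congr (_ *: _).
rewrite exprD /coef; field.
by rewrite expf_neq0.
Qed.

(** [conv] satisfies the characteristic identity, so by uniqueness it is the Whitney family. The
    weight [g] is left free to cover both identities. *)
Lemma sum_rWhitney2D (g : nat -> R) :
  \sum_(s < (l + n).+1) rWhitney2 m r (l + n) s * g s =
  \sum_(k < l.+1) \sum_(i < n.+1)
    m ^+ i * (m * k%:R + r) ^+ (n - i) * 'C(n, i)%:R * rWhitney2 m r l k
    * \sum_(j < i.+1) (stirling2 i j)%:R / m ^+ j * g (k + j)%N.
Proof.
have -> : rWhitney2 m r (l + n) = conv.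
  exact: is_rWhitney2_unique hm (rWhitney2P _ _ _) conv_rWhitney2.
rewrite (conv_sum R^o g); apply: eq_bigr => k _; apply: eq_bigr => i _.
rewrite mulr_sumr; apply: eq_bigr => j _.
by rewrite /coef -[_ *: _]/(_ * _); ring.
Qed.

End Addition.

Theorem theorem11 (R : realType) (m r : R) (hm : m != 0) (l n : nat) :
  (forall x y : R,
     rDowling2 m r (l + n) x y =
     \sum_(k < l.+1) \sum_(i < n.+1)
       m ^+ i * (m * k%:R + r) ^+ (n - i) * 'C(n, i)%:R * rWhitney2 m r l k
       * bell2 i (x - k%:R) (y / m) * ffactr x k * y ^+ k) /\
  rDowling m r (l + n) =
    \sum_(k < l.+1) \sum_(i < n.+1)
      m ^+ i * (m * k%:R + r) ^+ (n - i) * 'C(n, i)%:R * rWhitney2 m r l k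
      * bell i (1 / m).
Proof.
split=> [x y|].
  rewrite /rDowling2; under eq_bigr do rewrite -mulrA.
  rewrite (sum_rWhitney2D _ _ _ hm _ _ (fun s => ffactr x s * y ^+ s)).
  apply: eq_bigr => k _; apply: eq_bigr => i _.
  rewrite -[RHS]mulrA -[RHS]mulrA; congr (_ * _).
  rewrite /bell2 mulr_suml; apply: eq_bigr => j _.
  (* The weight at [k + j] splits into its value at [k] and the j-th term of the Bell polynomial at
     [x - k%:R] and [y / m]. *)
  rewrite ffactrD exprD expr_div_n -!mulrA; congr (_ * _).
  by ring.
rewrite /rDowling; under eq_bigr do rewrite -[rWhitney2 _ _ _ _]mulr1.
rewrite (sum_rWhitney2D _ _ _ hm _ _ (fun=> 1)).
apply: eq_bigr => k _; apply: eq_bigr => i _; congr (_ * _).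
apply: eq_bigr => j _.
by rewrite mulr1 expr_div_n expr1n mul1r.
Qed.
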